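(* Let $A$ be an octonion division algebra over a field $F$. For any $f(x)\in A[x]$, $$RMR(f(x))=R\big(C(f(x))\big),$$ that is, the set of all elements of $A$ that are roots of some right scalar multiple $f(x)c$ with $c\in A^\times$ is equal to the set of roots in $A$ of the companion polynomial $C(f(x))=\overline{f(x)}\cdot f(x)$.
   Context: Octonion algebras: let $Q$ be a quaternion algebra over a field $F$ (any characteristic) with canonical involution $z\mapsto\overline z$, and let $\gamma\in F^\times$. The octonion algebra $A=Q\oplus Q\ell$ has multiplication $(q+r\ell)(s+t\ell)=qs+\gamma\overline{t}r+(tq+r\overline{s})\ell$ for $q,r,s,t\in Q$, involution $\overline{q+r\ell}=\overline q-r\ell$, trace $\mathrm{Tr}(z)=z+\overline z\in F$ and norm $\mathrm{Norm}(z)=z\overline z\in F$. It is a division algebra iff every nonzero element is invertible, equivalently iff the norm form is anisotropic. $A^\times$ denotes the set of invertible elements of $A$. Polynomials: $A[x]=A\otimes_F F[x]$, so $x$ is central. For $f(x)=a_nx^n+\dots+a_1x+a_0\in A[x]$ and $\lambda\in A$, the substitution is $f(\lambda)=a_n\lambda^n+\dots+a_1\lambda+a_0$ (coefficients on the left); $\lambda$ is a root of $f$ if $f(\lambda)=0$, and $R(f(x))\subseteq A$ is the set of all roots of $f$ in $A$. For $c\in A^\times$, $f(x)c=(a_nc)x^n+\dots+(a_1c)x+a_0c$. Define $RMR(f(x))=\bigcup_{c\in A^\times}R(f(x)c)$. Let $\overline{f(x)}=\overline{a_n}x^n+\dots+\overline{a_0}$; the companion polynomial of $f$ is $C(f(x))=\overline{f(x)}\cdot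 f(x)$ (product in $A[x]$), whose coefficients lie in $F$. *)

(* Defs.v *)
From HB Require Import structures.
From mathcomp Require Import all_boot all_order all_algebra all_field.
From mathcomp Require Import finmap monalg.
From mathcomp Require Import boolp classical_sets.

Set Implicit Arguments.
Unset Strict Implicit.
Unset Printing Implicit Defensive.

Import GRing.Theory.

Local Open Scope ring_scope.
Local Open Scope classical_set_scope.

Section Quaternion.
Variables (F : fieldType) (Q : falgType F).

(* A quaternion algebra is a central simple F-algebra of dimension 4; this     *)
(* covers every characteristic.                                                *)
Record is_quaternion : Prop := IsQuaternion {
  quaternion_dim : \dim {:Q} = 4%N;
  quaternion_central : ('Z({:Q}) = 1)%VS;
  quaternion_simple : forall I : {vspace Q},
    ({:Q} * I <= I)%VS -> (I * {:Q} <= I)%VS -> I = 0%VS \/ I = fullv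
}.

(* The line 1%VS is the image of F in Q. The conditions on z + conj z and      *)
(* z * conj z single out the canonical involution among all involutions of Q,  *)
(* see canonical_involution_unique.                                            *)
Record is_canonical_involution (conj : 'End(Q)) : Prop := IsCanonicalInvolution {
  conj_antimul : forall z w, conj (z * w) = conj w * conj z;
  conj_involutive : involutive conj;
  conj_trace : forall z, z + conj z \in 1%VS;
  conj_norm : forall z, z * conj z \in 1%VS
}.

Lemma canonical_involution_unique (s t : 'End(Q)) :
  is_canonical_involution s -> is_canonical_involution t -> s = t.
Proof.
have inv1 (u : 'End(Q)) : is_canonical_involution u -> u 1 = 1.
  by case=> uM uK _ _; have := uM 1 (u 1); rewrite mul1r uK mul1r.
move=> cs ct; apply/lfunP => z.
have [/vlineP[k ->]|zF] := boolP (z \in 1%VS).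
  by rewrite !linearZ /= !inv1.
have /vlineP[a az] := conj_trace cs z; have /vlineP[b bz] := conj_trace ct z.
have /vlineP[c cz] := conj_norm cs z; have /vlineP[d dz] := conj_norm ct z.
have sz : s z = a%:A - z by rewrite -az addrC addKr.
have tz : t z = b%:A - z by rewrite -bz addrC addKr.
suff ab : a = b by rewrite sz tz ab.
apply/eqP; rewrite -subr_eq0; apply: contraNT zF => ab0.
have : (a - b) *: z = (c - d)%:A.
  rewrite scalerBl [in RHS]scalerBl -cz -dz sz tz !mulrBr.
  by rewrite -!scalerAr !mulr1 opprB addrA addrNK.
move=> /(congr1 (fun v => (a - b)^-1 *: v)).
rewrite scalerA mulVf // scale1r => ->.
by rewrite scalerA memvZ // memv_line.
Qed.

End Quaternion.

(* The pair (q, r) stands for q + r ell. The parameters conj and gamma occur   *)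
(* in the type so that the operations below can be inferred from it. Only the  *)
(* F-vector space structure is copied from Q * Q; its product ring structure   *)
(* is not the octonion multiplication.                                         *)
Definition octonion (F : fieldType) (Q : falgType F) (conj : 'End(Q))
  (gamma : F) : Type := (Q * Q)%type.

HB.instance Definition _ (F : fieldType) (Q : falgType F) (conj : 'End(Q))
  (gamma : F) := Vector.copy (octonion conj gamma) (Q * Q)%type.

Section Octonion.
Variables (F : fieldType) (Q : falgType F) (conj : 'End(Q)) (gamma : F).
Local Notation A := (octonion conj gamma).

Definition oct_one : A := (1, 0).

Definition oct_mul (z w : A) : A :=
  let: (q, r) := z in let: (s, t) := w in
  (q * s + gamma *: (conj t * r), t * q + r * conj s).

Definition oct_conj (z : A) : A := let: (q, r) := z in (conj q, - r).

(* A is not associative, but it is power-associative, so that the bracketing   *)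
(* chosen here is immaterial.                                                  *)
Definition oct_exp (z : A) (n : nat) : A := iter n (oct_mul z) oct_one.

Definition oct_unit : set A :=
  [set z | exists w, oct_mul z w = oct_one /\ oct_mul w z = oct_one].

Definition oct_division : Prop := forall z : A, z != 0 -> oct_unit z.

(* Elements of A[x] are finitely supported families of coefficients indexed by *)
(* the exponent: f@_n is the coefficient of x^n, and << a *g n >> is the       *)
(* monomial a x^n.                                                             *)
Definition oct_poly_mul (f g : {malg A[nat]}) : {malg A[nat]} :=
  \sum_(i <- msupp f) \sum_(j <- msupp g) << oct_mul f@_i g@_j *g (i + j)%N >>.

Definition oct_poly_conj (f : {malg A[nat]}) : {malg A[nat]} :=
  \sum_(i <- msupp f) << oct_conj f@_i *g i >>.

Definition oct_poly_scaler (f : {malg A[nat]}) (c : A) : {malg A[nat]} :=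
  \sum_(i <- msupp f) << oct_mul f@_i c *g i >>.

Definition companion (f : {malg A[nat]}) : {malg A[nat]} :=
  oct_poly_mul (oct_poly_conj f) f.

Definition oct_eval (f : {malg A[nat]}) (lambda : A) : A :=
  \sum_(i <- msupp f) oct_mul f@_i (oct_exp lambda i).

Definition root_set (f : {malg A[nat]}) : set A :=
  [set lambda | oct_eval f lambda = 0].

Definition RMR (f : {malg A[nat]}) : set A :=
  \bigcup_(c in oct_unit) root_set (oct_poly_scaler f c).

End Octonion.

(* Main.v *)
(* Since x ^ n = u_n x + v_n with u_n, v_n in F, evaluating at x replaces f by  *)
(* a linear polynomial a X + b, and the companion polynomial takes the value   *)
(* N(a) x^2 + <a, b> x + N(b), where <a, b> = N(a + b) - N(a) - N(b).          *)
(* If (a c) x + b c = 0 with N(c) != 0, multiplicativity of the norm gives     *)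
(* N(a) N(x) = N(b) and N(a) N(1 - x) = N(a + b), so this value is a multiple  *)
(* of x^2 - Tr(x) x + N(x) = 0. Conversely, if the value is 0 and a != 0,      *)
(* then right alternativity shows that c = N(a) x + conj(b) a works as soon as *)
(* it is nonzero; if it vanishes then b = - a conj(x), and any nonzero c       *)
(* orthogonal to 1 and conj(x) works.                                          *)
From HB Require Import structures.
Require Import Defs.
From mathcomp Require Import all_boot all_order all_algebra all_field.
From mathcomp Require Import finmap monalg.
From mathcomp Require Import boolp classical_sets.
From mathcomp Require Import ring.

Set Implicit Arguments.
Unset Strict Implicit.
Unset Printing Implicit Defensive.

Import GRing.Theory.

Local Open Scope ring_scope.
Local Open Scope classical_set_scope.

(** Fix x. Every power of x is u x + v with u, v in F, and scalars pass through all products, so f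
    can be replaced by one linear polynomial a X + b, the same for every multiplier c and for the
    companion: this is [oct_eval_affine]. What remains is [oct_linear_rootP], an equivalence about
    a, b and x alone. One direction, [oct_root_linear], only compares norms, where c cancels. The
    other, [oct_linear_root], exhibits c; right alternativity, [oct_mul_sqr], replaces associativity
    there. When that c vanishes, [oct_mul_conj_swap] and [oct_orthogonal_exists] supply another
    one. *)

Section LineCoef.
Variables (F : fieldType) (Q : falgType F).

(** Linear on all of [Q], so that traces and norms become elements of F with no membership proof
    attached. *)
Definition line_coef (q : Q) : F := coord [tuple of [:: (1 : Q)]] ord0 q.

HB.instance Definition _ := GRing.Linear.copy line_coef
  (coord [tuple of [:: (1 : Q)]] ord0).

Lemma line_coef1 : line_coef 1 = 1.
Proof.
by rewrite /line_coef (coord_free ord0 ord0) // seq1_free oner_neq0.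
Qed.

Lemma line_coefZ1 (k : F) : line_coef k%:A = k.
Proof. by rewrite linearZ /= line_coef1 mulr1. Qed.

Lemma line_coefK (q : Q) : q \in 1%VS -> (line_coef q)%:A = q.
Proof. by case/vlineP=> k ->; rewrite line_coefZ1. Qed.

End LineCoef.

Section ScalarMultiplication.
Variables (F : fieldType) (Q : falgType F).

Lemma mulr_algr k (x : Q) : x * k%:A = k *: x.
Proof. by rewrite -scalerAr mulr1. Qed.

Lemma mulr_algl k (x : Q) : k%:A * x = k *: x.
Proof. by rewrite -scalerAl mul1r. Qed.

End ScalarMultiplication.

(** * Trace and norm of the quaternion algebra *)

Section QuaternionNorm.
Variables (F : fieldType) (Q : falgType F) (conj : 'End(Q)).
Hypothesis Hconj : is_canonical_involution conj.

Definition qtr (q : Q) : F := line_coef (q + conj q).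
Definition qnorm (q : Q) : F := line_coef (q * conj q).

Lemma qtr_is_scalar : scalar qtr.
Proof. by move=> k q r; rewrite /qtr linearP addrACA -scalerDr linearP. Qed.

HB.instance Definition _ := GRing.isLinear.Build F Q F *%R qtr qtr_is_scalar.

Lemma qconjM z w : conj (z * w) = conj w * conj z.
Proof. by case: Hconj. Qed.

Lemma qconjK z : conj (conj z) = z.
Proof. by case: Hconj. Qed.

Lemma qconj1 : conj 1 = 1.
Proof. by have := qconjM 1 (conj 1); rewrite mul1r qconjK mul1r. Qed.

Lemma add_qconj q : q + conj q = (qtr q)%:A.
Proof. by rewrite line_coefK //; case: Hconj. Qed.

Lemma mul_qconj q : q * conj q = (qnorm q)%:A.
Proof. by rewrite line_coefK //; case: Hconj. Qed.

Lemma qconjE q : conj q = (qtr q)%:A - q.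
Proof. by rewrite -add_qconj addrC addKr. Qed.

Lemma mul_qconjl q : conj q * q = (qnorm q)%:A.
Proof.
by rewrite -mul_qconj qconjE mulrBl mulrBr -scalerAl -scalerAr mul1r mulr1.
Qed.

Lemma qnorm_conj q : qnorm (conj q) = qnorm q.
Proof.
by rewrite /qnorm qconjK mul_qconjl line_coefZ1.
Qed.

Lemma qtr_conj q : qtr (conj q) = qtr q.
Proof. by rewrite /qtr qconjK addrC. Qed.

Lemma qnormM q r : qnorm (q * r) = qnorm q * qnorm r.
Proof.
rewrite {1}/qnorm qconjM -mulrA (mulrA r) mul_qconj -scalerAl mul1r -scalerAr.
by rewrite mul_qconj scalerA line_coefZ1 mulrC.
Qed.

Lemma qnormZ k q : qnorm (k *: q) = k ^+ 2 * qnorm q.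
Proof.
by rewrite /qnorm linearZ /= -scalerAl -scalerAr !linearZ /= mulrA expr2.
Qed.

Lemma qnormN q : qnorm (- q) = qnorm q.
Proof. by rewrite /qnorm linearN mulrNN. Qed.

Lemma qnorm1 : qnorm 1 = 1.
Proof. by rewrite /qnorm qconj1 mulr1 line_coef1. Qed.

Lemma qnormD q r : qnorm (q + r) = qnorm q + qnorm r + qtr (q * conj r).
Proof.
rewrite /qnorm /qtr linearD mulrDl !mulrDr qconjM qconjK !linearD /=; ring.
Qed.

(** The elements q + conj r and conj q + r are conjugate, hence have equal norms; the cross terms of
    these norms are tr(q r) and tr(conj(r q)). *)
Lemma qtrM q r : qtr (q * r) = qtr (r * q).
Proof.
have : qnorm (q + conj r) = qnorm (conj q + r).
  by rewrite -(qnorm_conj (conj q + r)) linearD /= qconjK.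
rewrite !qnormD !qnorm_conj qconjK => /addrI ->.
by rewrite -qconjM qtr_conj.
Qed.

End QuaternionNorm.

(** * Octonion multiplication, norm and alternativity *)

Section OctonionAlgebra.
Variables (F : fieldType) (Q : falgType F) (conj : 'End(Q)) (gamma : F).
Hypothesis Hconj : is_canonical_involution conj.
Local Notation A := (octonion conj gamma).
Local Notation one := (oct_one conj gamma).
Local Infix "**" := (@oct_mul F Q conj gamma) (at level 40, left associativity).
Local Notation oconj := (@oct_conj F Q conj gamma).

Lemma oct_mulDl (x y z : A) : (x + y) ** z = x ** z + y ** z.
Proof.
case: x y z => [q r] [q' r'] [s t]; congr pair => /=.
  by rewrite mulrDl mulrDr scalerDr addrACA.
by rewrite mulrDr mulrDl addrACA.
Qed.

Lemma oct_mulDr (x y z : A) : x ** (y + z) = x ** y + x ** z.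
Proof.
case: x y z => [q r] [s t] [s' t']; congr pair => /=.
  by rewrite linearD mulrDr mulrDl scalerDr addrACA.
by rewrite linearD mulrDr mulrDl addrACA.
Qed.

Lemma oct_mulZl k (x y : A) : (k *: x) ** y = k *: (x ** y).
Proof.
case: x y => [q r] [s t]; congr pair => /=.
  by rewrite -scalerAl -scalerAr scalerDr !scalerA (mulrC k).
by rewrite -scalerAl -scalerAr scalerDr.
Qed.

Lemma oct_mulZr k (x y : A) : x ** (k *: y) = k *: (x ** y).
Proof.
case: x y => [q r] [s t]; congr pair => /=.
  by rewrite linearZ /= -scalerAl -scalerAr scalerDr !scalerA (mulrC k).
by rewrite linearZ /= -scalerAl -scalerAr scalerDr.
Qed.

HB.instance Definition _ (x : A) := GRing.isLinear.Build F A A *:%R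
  (oct_mul x)
  (fun k y z => etrans (oct_mulDr _ _ _) (congr1 (+%R^~ _) (oct_mulZr k x y))).

(* Right multiplication as a function of the left factor, so that it can carry *)
(* a linear structure.                                                         *)
Definition oct_mulr (y x : A) := x ** y.

HB.instance Definition _ (y : A) := GRing.isLinear.Build F A A *:%R
  (oct_mulr y)
  (fun k x z => etrans (oct_mulDl _ _ _) (congr1 (+%R^~ _) (oct_mulZl k x y))).

Lemma oct_mulBl (x y z : A) : (x - y) ** z = x ** z - y ** z.
Proof. exact: (linearB (oct_mulr z)). Qed.

Lemma oct_mul0l (z : A) : 0 ** z = 0.
Proof. exact: (linear0 (oct_mulr z)). Qed.

Lemma oct_mul_suml I (r : seq I) (P : pred I) (E : I -> A) (z : A) :
  (\sum_(i <- r | P i) E i) ** z = \sum_(i <- r | P i) (E i ** z).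
Proof. exact: (linear_sum (oct_mulr z)). Qed.

Lemma oct_conj_is_linear : linear oconj.
Proof.
move=> k [q r] [s t]; congr pair => /=; first by rewrite linearP.
by rewrite opprD scalerN.
Qed.

HB.instance Definition _ :=
  GRing.isLinear.Build F A A *:%R oconj oct_conj_is_linear.

Lemma oct_mul1l (x : A) : one ** x = x.
Proof.
by case: x => q r; rewrite /oct_mul /oct_one mul1r mulr0 scaler0 addr0 mulr1 mul0r addr0.
Qed.

Lemma oct_mul1r (x : A) : x ** one = x.
Proof.
case: x => q r; rewrite /oct_mul /oct_one linear0 (qconj1 Hconj) !mul0r.
by rewrite scaler0 !mulr1 addr0 add0r.
Qed.

Definition onorm (x : A) : F := qnorm conj x.1 - gamma * qnorm conj x.2.
Definition otr (x : A) : F := qtr conj x.1.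

Lemma oct_conjE x : oconj x = otr x *: one - x.
Proof.
case: x => q r; congr pair; first exact: qconjE.
by rewrite /= scaler0 sub0r.
Qed.

Lemma oct_conjM (x y : A) : oconj (x ** y) = oconj y ** oconj x.
Proof.
case: x y => [q r] [s t]; congr pair => /=.
  rewrite linearD linearZ /= !(qconjM Hconj) (qconjK Hconj) linearN /= mulNr.
  by rewrite mulrN opprK.
by rewrite (qconjK Hconj) mulNr mulNr opprD addrC.
Qed.

Lemma oct_conjK (x : A) : oconj (oconj x) = x.
Proof. by case: x => q r; rewrite /= (qconjK Hconj) opprK. Qed.

Lemma oct_mul_conj (x : A) : x ** oconj x = onorm x *: one.
Proof.
case: x => q r; congr pair => /=.
  rewrite linearN mulNr (mul_qconj Hconj) (mul_qconjl Hconj) /onorm /= scalerBl.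
  by rewrite scalerN scalerA.
by rewrite (qconjK Hconj) scaler0 mulNr addrC subrr.
Qed.

Lemma onorm_conj (x : A) : onorm (oconj x) = onorm x.
Proof. by case: x => q r; rewrite /onorm /= (qnorm_conj Hconj) qnormN. Qed.

Lemma oct_conj_mul (x : A) : oconj x ** x = onorm x *: one.
Proof. by rewrite -{2}(oct_conjK x) oct_mul_conj onorm_conj. Qed.

Lemma oct_sqr (x : A) : x ** x = otr x *: x - onorm x *: one.
Proof.
apply/eqP; rewrite eq_sym subr_eq addrC -oct_mul_conj oct_conjE linearB linearZ /=.
by rewrite oct_mul1r subrK.
Qed.

Lemma onormM (x y : A) : onorm (x ** y) = onorm x * onorm y.
Proof.
case: x y => [q r] [s t]; rewrite /onorm /= !(qnormD Hconj).
rewrite !(qnormZ, qnormM Hconj, qnorm_conj Hconj).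
(* The cross terms of the two component norms agree by cyclicity of the trace, so they cancel in
   [onorm]. *)
have -> : qtr conj (q * s * conj (gamma *: (conj t * r))) =
          gamma * qtr conj (t * q * conj (r * conj s)).
  rewrite linearZ /= -scalerAr !(qconjM Hconj) !(qconjK Hconj).
  rewrite -!mulrA (qtrM Hconj t) /qtr linearZ -scalerDr linearZ /=.
  by rewrite !mulrA.
ring.
Qed.

(** Polar form of the norm, without a factor 1/2, so that characteristic 2 is covered. *)
Definition odot (x y : A) : F := onorm (x + y) - onorm x - onorm y.

Lemma onorm1 : onorm one = 1.
Proof.
by rewrite /onorm /= (qnorm1 Hconj) /qnorm mul0r linear0 mulr0 subr0.
Qed.

Lemma onorm0 : onorm 0 = 0.
Proof. by rewrite /onorm /= /qnorm mul0r linear0 mulr0 subr0. Qed.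

Lemma oct_one_neq0 : one != 0.
Proof. by apply: contra_neq (oner_neq0 F) => e; rewrite -onorm1 e onorm0. Qed.

Lemma onormN (x : A) : onorm (- x) = onorm x.
Proof. by rewrite /onorm /= !qnormN. Qed.

Lemma odot_conj (x y : A) : oconj x ** y + oconj y ** x = odot x y *: one.
Proof.
rewrite /odot 2!scalerBl -!oct_conj_mul (linearD oconj) oct_mulDl !oct_mulDr.
rewrite -[in RHS]addrA -opprD [oconj y ** x + _ ** _]addrC addrACA.
by rewrite [in RHS]addrC addKr addrC.
Qed.

(** Holds componentwise because s + conj s, t conj t and conj t t are scalars. The other rules for
    moving brackets are derived from this one. *)
Lemma oct_mul_sqr (x y : A) : x ** y ** y = x ** (y ** y).
Proof.
case: x y => [q r] [s t]; congr pair => /=.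
  rewrite mulrDl -scalerAl -[LHS]addrA -scalerDr [in RHS]mulrDr mulrA.
  rewrite -scalerAr -[RHS]addrA -[in RHS]scalerDr; congr (_ + _ *: _).
  rewrite -mulrDr (add_qconj Hconj) mulr_algr linearZ -scalerAl /=.
  rewrite mulrDr !mulrA -(mulrA q) (mul_qconjl Hconj) mulr_algr mulr_algl.
  by rewrite addrCA -mulrDr (add_qconj Hconj) mulr_algr.
rewrite -mulrDr (add_qconj Hconj) mulr_algr -scalerAl.
rewrite linearD linearZ /= (mul_qconjl Hconj) linearZ /= (qconj1 Hconj).
rewrite [in RHS]mulrDr scalerA mulr_algr [in LHS]mulrDr mulrDl -scalerAr !mulrA.
rewrite (mul_qconj Hconj) mulr_algl (qconjM Hconj) mulrA scalerA.
rewrite addrACA -mulrDr (add_qconj Hconj).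
by rewrite mulr_algr [_ + r * _ * _]addrC.
Qed.

Lemma onorm_1B (x : A) : onorm (one - x) = 1 - otr x + onorm x.
Proof.
rewrite /onorm /otr /= (qnormD Hconj) (qnorm1 Hconj) sub0r !qnormN mul1r.
rewrite linearN [qtr _ (- _)]/qtr /= linearN -opprD linearN /= -/(qtr _ _).
by rewrite (qtr_conj Hconj); ring.
Qed.

Arguments oct_mul : simpl never.
Arguments oct_conj : simpl never.

(** Conjugation turns this into (conj y x) conj x = N(x) conj y, which follows from right
    alternativity and [oct_sqr], since conj x = Tr(x) - x. *)
Lemma oct_mul_conj_mul (x y : A) : x ** (oconj x ** y) = onorm x *: y.
Proof.
rewrite -{1}(oct_conjK (oconj x ** y)) oct_conjM oct_conjK -{1}(oct_conjK x).
rewrite -oct_conjM (oct_conjE x) oct_mulDr (linearN (oct_mul _)) /=.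
rewrite oct_mul_sqr oct_sqr oct_mulZr oct_mul1r (linearB (oct_mul _)) /=.
by rewrite !oct_mulZr oct_mul1r opprB addrC subrK linearZ /= oct_conjK.
Qed.

(** * Roots of a linear polynomial and of its companion *)

Lemma oct_root_linear (a b c x : A) : onorm c != 0 ->
  a ** c ** x + b ** c = 0 ->
  onorm a *: (x ** x) + odot a b *: x + onorm b *: one = 0.
Proof.
move=> c0 abc.
have Nb : onorm a * onorm x = onorm b.
  apply: (mulIf c0); rewrite mulrAC -!onormM.
  by move/eqP: abc; rewrite addr_eq0 => /eqP ->; rewrite onormN.
(* The choice of [one - x] comes from (a c)(1 - x) = a c + b c = (a + b) c; its norm determines
   [odot a b]. *)
have Nab : onorm a * onorm (one - x) = onorm (a + b).
  apply: (mulIf c0); rewrite mulrAC -!onormM.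
  rewrite (linearB (oct_mul _)) /= oct_mul1r oct_mulDl.
  by move/eqP: abc; rewrite addrC addr_eq0 => /eqP ->.
have -> : odot a b = - (onorm a * otr x).
  by rewrite /odot -Nab -Nb onorm_1B; ring.
rewrite oct_sqr -Nb scalerBr !scalerA scaleNr.
by rewrite addrAC subrK subrr.
Qed.

(** This c is the value at x of g = (conj a X + conj b) a. With associativity, (a X + b) g would be
    a times the companion, which vanishes at x, and its value at x would be a c x + b c. The
    computation below needs only alternativity. *)
Lemma oct_linear_root (a b x : A) (c := onorm a *: x + oconj b ** a) :
  onorm a *: (x ** x) + odot a b *: x + onorm b *: one = 0 ->
  a ** c ** x + b ** c = 0.
Proof.
move=> Cx.
have ac : a ** c = onorm a *: (a ** x) + (odot a b *: a - onorm a *: b).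
  rewrite oct_mulDr oct_mulZr; congr (_ + _).
  have -> : oconj b ** a = odot a b *: one - oconj a ** b.
    by rewrite -odot_conj addrC addKr.
  by rewrite linearB linearZ /= oct_mul1r oct_mul_conj_mul.
have -> : a ** c ** x = - (onorm b *: a) - onorm a *: (b ** x).
  rewrite ac addrA oct_mulDl -scaleNr oct_mulZl scaleNr; congr (_ - _).
  rewrite oct_mulDl !oct_mulZl oct_mul_sqr -!(oct_mulZr _ a) -oct_mulDr.
  move/eqP: Cx; rewrite addr_eq0 => /eqP ->.
  by rewrite linearN linearZ /= oct_mul1r.
by rewrite oct_mulDr oct_mulZr oct_mul_conj_mul addrA subrK addNr.
Qed.

(** Both c and c x are skew, so c x = conj x c, and c x + x c = Tr(x) c. Linearized right
    alternativity then gives (a c) x + (a x) c = Tr(x) a c. *)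
Lemma oct_mul_conj_swap (a c x : A) : otr c = 0 -> otr (c ** x) = 0 ->
  a ** c ** x = a ** oconj x ** c.
Proof.
move=> c0 cx0.
have cE : oconj c = - c by rewrite oct_conjE c0 scale0r sub0r.
have cx : c ** x = oconj x ** c.
  apply/eqP; rewrite -subr_eq0; apply/eqP.
  rewrite -[RHS](scale0r one) -cx0.
  rewrite -[RHS](subrK (c ** x)) -oct_conjE oct_conjM cE.
  by rewrite (linearN (oct_mul (oconj x))) /= addrC.
have : a ** c ** x + a ** x ** c = a ** (c ** x + x ** c).
  have := oct_mul_sqr a (c + x).
  rewrite !(oct_mulDr, oct_mulDl) !oct_mul_sqr -!addrA => /addrI.
  by rewrite !addrA => /addIr; rewrite addrC => ->; rewrite addrC.
have xx : oconj x + x = otr x *: one by rewrite oct_conjE subrK.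
rewrite cx -oct_mulDl xx oct_mulZl oct_mul1l oct_mulZr => /eqP.
rewrite eq_sym -subr_eq => /eqP <-.
by rewrite oct_conjE linearB linearZ /= oct_mul1r oct_mulBl oct_mulZl.
Qed.

Lemma oct_orthogonal_exists (x : A) : \dim {:Q} != 1%N ->
  exists2 c : A, c != 0 & otr c = 0 /\ otr (c ** x) = 0.
Proof.
(* Each c = t ell has trace 0, and Tr(c x) is a linear form in t, which has a nonzero kernel vector
   as [Q] is not a line. *)
move=> dQ; pose f (t : Q) := qtr conj (gamma *: (conj x.2 * t)).
have otrE t : otr ((0, t) ** x) = f t.
  by case: x @f => s u; rewrite /otr /= mul0r add0r.
have otr0 t : otr (0, t) = 0 by rewrite /otr /= /qtr linear0 addr0 linear0.
suff [t t0 ft] : exists2 t, t != 0 & f t = 0.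
  exists (0, t); last by rewrite otrE otr0.
  by apply: contra t0 => /eqP[->].
have [f1|f1] := eqVneq (f 1) 0; first by exists 1; rewrite ?oner_neq0.
have [u uF] : exists u : Q, u \notin 1%VS.
  apply: contrapT => nu; case/eqP: dQ; apply: etrans (dimv1 Q).
  congr (\dim _); apply/vspaceP => u; rewrite memvf; apply/esym.
  by apply: contrapT => /negP uF; apply: nu; exists u.
have fB k l s t : f (k *: s - l *: t) = k * f s - l * f t.
  rewrite /f mulrBr -!scalerAr scalerBr !linearB !linearZ /=.
  by rewrite !mulrA !(mulrC gamma).
exists (f u *: 1 - f 1 *: u); last by rewrite fB mulrC subrr.
apply: contraNneq uF => /eqP; rewrite subr_eq0 => /eqP e.
by rewrite -[u](scalerK f1) -e !memvZ // memv_line.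
Qed.

Lemma onorm_neq0 (x : A) : oct_division conj gamma -> x != 0 -> onorm x != 0.
Proof.
move=> HA /HA[w [xw _]]; apply: contra_neq (oner_neq0 F) => x0.
by rewrite -onorm1 -xw onormM x0 mul0r.
Qed.

Lemma oct_linear_rootP (a b x : A) :
    oct_division conj gamma -> \dim {:Q} != 1%N ->
  (exists2 c, oct_unit c & a ** c ** x + b ** c = 0) <->
  onorm a *: (x ** x) + odot a b *: x + onorm b *: one = 0.
Proof.
move=> HA dQ; have NH (y : A) := @onorm_neq0 y HA.
split=> [[c [w [cw _]]]|Cx].
  apply: oct_root_linear; apply: contra_eq_neq cw => c0.
  apply: contra_neq (oner_neq0 F) => /(congr1 onorm).
  by rewrite onormM c0 mul0r onorm1.
(* If a = 0, the quadratic value is N(b), so b = 0 and any unit c works. *)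
have [a0|/NH a0] := eqVneq a 0.
  exists one; first by exists one; rewrite oct_mul1l.
  suff -> : b = 0 by rewrite a0 !oct_mul0l addr0.
  apply/eqP; apply: contraT => /NH/negP[].
  move/eqP: Cx; rewrite /odot a0 add0r onorm0 subr0 subrr !scale0r !add0r.
  by rewrite scaler_eq0 (negPf oct_one_neq0) orbF.
have [c0|c0] := eqVneq (onorm a *: x + oconj b ** a) 0; last first.
  by eexists; [apply: HA c0 | apply: oct_linear_root].
(* The candidate vanishes, so a X + b is a (X - conj x). *)
have bE : b = - (a ** oconj x).
  apply: (scalerI a0); rewrite -oct_mul_conj_mul scalerN -oct_mulZr.
  move/(congr1 oconj)/eqP: c0.
  rewrite linearD linearZ linear0 /= oct_conjM oct_conjK addr_eq0 => /eqP ->.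
  by rewrite (linearN (oct_mul a)) opprK.
have [c /HA uc [cT cxT]] := oct_orthogonal_exists x dQ.
exists c => //; rewrite oct_mul_conj_swap // bE -scaleN1r oct_mulZl scaleN1r.
exact: subrr.
Qed.

End OctonionAlgebra.

Arguments oct_mul : simpl never.
Arguments oct_conj : simpl never.

(** * Evaluation at a fixed octonion *)

Section Evaluation.
Variables (F : fieldType) (Q : falgType F) (conj : 'End(Q)) (gamma : F).
Hypothesis Hconj : is_canonical_involution conj.
Local Notation A := (octonion conj gamma).
Local Notation one := (oct_one conj gamma).
Local Infix "**" := (@oct_mul F Q conj gamma) (at level 40, left associativity).
Local Notation oconj := (@oct_conj F Q conj gamma).
Implicit Type (f : {malg A[nat]}).

Lemma oct_evalEw f (d : {fset nat}) (x : A) :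
  (msupp f `<=` d)%fset -> oct_eval f x = \sum_(i <- d) f@_i ** oct_exp x i.
Proof.
move=> fd; apply: big_fset_incl => // i _ /mcoeff_outdom ->.
exact: oct_mul0l.
Qed.

Lemma oct_evalD f g x : oct_eval (f + g) x = oct_eval f x + oct_eval g x.
Proof.
rewrite (oct_evalEw x (msuppD_le f g)) (oct_evalEw x (fsubsetUl _ (msupp g))).
rewrite (oct_evalEw x (fsubsetUr (msupp f) (msupp g))) -big_split.
by apply: eq_bigr => i _; rewrite mcoeffD oct_mulDl.
Qed.

Lemma oct_eval0 x : oct_eval (0 : {malg A[nat]}) x = 0.
Proof. by rewrite /oct_eval msupp0 big_seq_fset0. Qed.

Lemma oct_eval_sum I (r : seq I) (E : I -> {malg A[nat]}) x :
  oct_eval (\sum_(i <- r) E i) x = \sum_(i <- r) oct_eval (E i) x.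
Proof. exact: (big_morph _ (fun f g => oct_evalD f g x) (oct_eval0 x)). Qed.

Lemma oct_evalU (a : A) i x : oct_eval << a *g i >> x = a ** oct_exp x i.
Proof. by rewrite (oct_evalEw x msuppU_le) big_seq_fset1 mcoeffUU. Qed.

Lemma oct_eval_scaler f c x :
  oct_eval (oct_poly_scaler f c) x = \sum_(i <- msupp f) f@_i ** c ** oct_exp x i.
Proof. by rewrite oct_eval_sum; apply: eq_bigr => i _; rewrite oct_evalU. Qed.

Lemma mcoeff_oct_poly_conj f i : (oct_poly_conj f)@_i = oconj f@_i.
Proof.
rewrite {2}(monalgE f) !raddf_sum /=; apply: eq_bigr => j _.
by rewrite !mcoeffU raddfMn.
Qed.

Lemma oct_eval_companion f x :
  oct_eval (companion f) x =
  \sum_(i <- msupp f) \sum_(j <- msupp f)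
     oconj f@_i ** f@_j ** oct_exp x (i + j)%N.
Proof.
rewrite oct_eval_sum.
under eq_bigr => i _.
  rewrite oct_eval_sum.
  under eq_bigr do rewrite oct_evalU mcoeff_oct_poly_conj.
  over.
(* Conjugation creates no new exponents, so the outer sum may run over the support of f. *)
apply: big_fset_incl => [|i _].
  apply/fsubsetP => i; rewrite -!mcoeff_neq0 mcoeff_oct_poly_conj.
  by apply: contra_neq => ->; rewrite linear0.
rewrite -mcoeff_eq0 mcoeff_oct_poly_conj => /eqP ->.
by apply: big1 => j _; rewrite !oct_mul0l.
Qed.

Lemma oct_quadratic_reduce (k l m : F) (x : A) :
  k *: (x ** x) + l *: x + m *: one =
  (k * otr x + l) *: x + (m - k * onorm x) *: one.
Proof.
rewrite oct_sqr // scalerBr !scalerA scalerDl scalerBl.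
by rewrite [X in X + _]addrAC -[LHS]addrA; congr (_ + _); exact: addrC.
Qed.

(** The pair (u_n, v_n) with x^n = u_n x + v_n; the recursion is x^2 = Tr(x) x - N(x). *)
Fixpoint exp_coefs (x : A) n : F * F :=
  if n is m.+1 then
    let: (u, v) := exp_coefs x m in (u * otr x + v, - (u * onorm x))
  else (0, 1).

Lemma oct_mul_affine (u v : F) (x : A) :
  x ** (u *: x + v *: one) = (u * otr x + v) *: x + (- (u * onorm x)) *: one.
Proof.
have := oct_quadratic_reduce u v 0 x; rewrite scale0r addr0 add0r => <-.
by rewrite linearD !linearZ /= oct_mul1r.
Qed.

Lemma oct_expE x n :
  oct_exp x n = (exp_coefs x n).1 *: x + (exp_coefs x n).2 *: one.
Proof.
elim: n => [|n IHn]; first by rewrite /= scale0r add0r scale1r.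
rewrite [oct_exp _ _]/= -/(oct_exp x n) {}IHn oct_mul_affine /=.
by case: exp_coefs.
Qed.

(** The product (p.1 x + p.2)(q.1 x + q.2), with x^2 left unreduced so that summing over i and j
    yields N(a), <a, b> and N(b) as coefficients. *)
Lemma oct_expD x i j (p := exp_coefs x i) (q := exp_coefs x j) :
  oct_exp x (i + j) =
  (p.1 * q.1) *: (x ** x) + (p.1 * q.2 + p.2 * q.1) *: x + (p.2 * q.2) *: one.
Proof.
rewrite {}/p; elim: i => [|i IHi].
  by rewrite /= !mul0r scale0r !add0r !mul1r; exact: oct_expE.
rewrite [oct_exp _ _]/= -/(oct_exp x (i + j)) {}IHi /=.
case: exp_coefs q => u v [u' v'] /=.
by rewrite !oct_quadratic_reduce oct_mul_affine; congr (_ *: _ + _ *: _); ring.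
Qed.

Lemma oct_eval_affine f x : exists a b : A,
  (forall c, oct_eval (oct_poly_scaler f c) x = a ** c ** x + b ** c) /\
  oct_eval (companion f) x =
  onorm a *: (x ** x) + odot a b *: x + onorm b *: one.
Proof.
pose u i := (exp_coefs x i).1; pose v i := (exp_coefs x i).2.
pose a := \sum_(i <- msupp f) u i *: f@_i.
pose b := \sum_(i <- msupp f) v i *: f@_i.
exists a, b; split => [c|].
  rewrite oct_eval_scaler !oct_mul_suml -big_split; apply: eq_bigr => i _.
  by rewrite oct_expE oct_mulDr !oct_mulZr oct_mul1r //= !oct_mulZl.
(* N(a), <a, b> and N(b) are S u u, S u v + S v u and S v v. *)
pose S (w z : nat -> F) :=
  \sum_(i <- msupp f) \sum_(j <- msupp f) (w i * z j) *: (oconj f@_i ** f@_j).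
have SE w z : S w z = oconj (\sum_(i <- msupp f) w i *: f@_i) **
                      (\sum_(j <- msupp f) z j *: f@_j).
  rewrite [oconj _]linear_sum oct_mul_suml; apply: eq_bigr => i _ /=.
  rewrite linear_sum; apply: eq_bigr => j _ /=.
  by rewrite !linearZ /= oct_mulZl scalerA mulrC.
have oneZ k (y : A) : k *: y = (k *: one) ** y by rewrite oct_mulZl oct_mul1l.
rewrite (oneZ (onorm a)) (oneZ (odot a b)) -oct_conj_mul // -odot_conj //.
rewrite -oct_conj_mul // -!SE oct_mulDl oct_eval_companion !oct_mul_suml.
rewrite -!big_split; apply: eq_bigr => i _ /=.
rewrite !oct_mul_suml -!big_split; apply: eq_bigr => j _ /=.
rewrite oct_expD !(oct_mulDr, oct_mulZr, oct_mulZl) oct_mul1r //.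
by rewrite scalerDl.
Qed.

End Evaluation.

Theorem theorem3p3 (F : fieldType) (Q : falgType F) (conj : 'End(Q)) (gamma : F)
  (HQ : is_quaternion Q) (Hconj : is_canonical_involution conj)
  (Hgamma : gamma != 0) (HA : oct_division conj gamma)
  (f : {malg (octonion conj gamma)[nat]}) :
  RMR f = root_set (companion f).
Proof.
apply/seteqP; split=> x; rewrite /RMR /root_set /=;
  have [a [b [fcE CE]]] := oct_eval_affine Hconj f x;
  have dQ : \dim {:Q} != 1%N by rewrite (quaternion_dim HQ).
  case=> c uc /=; rewrite fcE CE => fc0.
  by apply/(oct_linear_rootP _ _ _ _ HA dQ) => //; exists c.
rewrite CE => /(oct_linear_rootP _ _ _ _ HA dQ)[//|c uc c0].
by exists c => //=; rewrite fcE.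
Qed.
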